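(* Let $G=(V,E)$ be a finite graph with neither loops nor multiple edges, and let $\Upsilon_{a,p,q}$ be the marginal on $\Omega=\{0,1\}^E$ of the diluted-random-cluster measure $\phi_{a,p,q}$ on $G$. Let $0<a_1\le a_2<1$, $0<p_1\le p_2<1$, and $q\in[1,2]$. Then $\Upsilon_{a_1,p_1,q}\le_{\rm st}\Upsilon_{a_2,p_2,q}$.
   Context: Let $\Psi=\{0,1\}^V$, $\Omega=\{0,1\}^E$. For $\psi\in\Psi$ let $V_\psi=\{x\in V:\psi_x=1\}$ and $E_\psi=\{\langle x,y\rangle\in E:x,y\in V_\psi\}$; for $\omega\in\Omega$ let $\eta(\omega)=\{e\in E:\omega_e=1\}$. Let $\Theta$ be the set of pairs $(\psi,\omega)\in\Psi\times\Omega$ with $\eta(\omega)\subseteq E_\psi$, and for $\theta=(\psi,\omega)\in\Theta$ let $k(\theta)$ be the number of connected components of the graph $(V_\psi,\eta(\omega))$. With $r=\sqrt{1-p}$, the diluted-random-cluster measure on $G$ with parameters $a\in(0,1)$, $p\in[0,1)$, $q\in(0,\infty)$ is the probability measure on $\Psi\times\Omega$ given by $$\phi_{a,p,q}(\theta)=\frac1Z\,r^{|E_\psi|}q^{k(\theta)}\prod_{x\in V}\Big(\frac a{1-a}\Big)^{\psi_x}\prod_{e\in E_\psi}\Big(\frac p{1-p}\Big)^{\omega_e},\qquad\theta=(\psi,\omega)\in\Theta,$$ and $\phi_{a,p,q}(\theta)=0$ otherwise, with $Z$ the normalizing constant. The edge-marginal is $\Upsilon_{a,p,q}(\omega)=\sum_{\psi\in\Psi}\phi_{a,p,q}(\psi,\omega)$.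 For probability measures $\mu_1,\mu_2$ on $\{0,1\}^I$, with the coordinatewise partial order, $\mu_1\le_{\rm st}\mu_2$ means $\mu_1(f)\le\mu_2(f)$ for all increasing functions $f:\{0,1\}^I\to\mathbb R$, where $\mu(f)$ denotes expectation. *)

(* Defs.v *)
From mathcomp Require Import all_boot all_order all_algebra.
From mathcomp Require Import reals.

Set Implicit Arguments.
Unset Strict Implicit.
Unset Printing Implicit Defensive.

Import Order.TTheory GRing.Theory Num.Theory.
Local Open Scope ring_scope.

(* Finite probability measures on [{ffun I -> bool}] are given by their mass
   functions. *)
Section StochasticOrder.
Variables (R : realType) (I : finType).
Implicit Types (w : {ffun I -> bool}) (mu f : {ffun I -> bool} -> R).

Definition config_le w w' : Prop := forall i, (w i <= w' i)%N.

Definition increasing f : Prop :=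
  forall w w', config_le w w' -> f w <= f w'.

Definition expectation mu f : R := \sum_w mu w * f w.

Definition st_le (mu1 mu2 : {ffun I -> bool} -> R) : Prop :=
  forall f, increasing f -> expectation mu1 f <= expectation mu2 f.

End StochasticOrder.

(* A simple graph on the vertex set V is a set of two-element subsets of V:
   neither loops nor multiple edges can occur. *)
Definition simple_graph (V : finType) (E : {set {set V}}) : Prop :=
  forall e, e \in E -> #|e| = 2%N.

Section DilutedRandomCluster.
Variables (V : finType) (E : {set {set V}}).
Local Notation edge := {e : {set V} | e \in E}.
Implicit Types (psi : {ffun V -> bool}) (omega : {ffun edge -> bool}).

Definition open_vertices psi : {set V} := [set x | psi x].

Definition induced_edges psi : {set edge} :=
  [set e : edge | val e \subset open_vertices psi].

Definition open_edges omega : {set edge} := [set e | omega e].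

Definition compatible psi omega : bool :=
  open_edges omega \subset induced_edges psi.

Definition open_adj omega : rel V :=
  fun x y => [exists e in open_edges omega, val e == [set x; y]].

(* [n_comp] counts connected components inside an adjacency-closed set, so this
   is the number of components of (V_psi, eta(omega)) when
   [compatible psi omega]; it is used only in that case. *)
Definition num_components psi omega : nat :=
  n_comp (open_adj omega) (open_vertices psi).

Variable R : realType.
Implicit Types a p q : R.

Definition drc_weight a p q psi omega : R :=
  if compatible psi omega then
    Num.sqrt (1 - p) ^+ #|induced_edges psi|
    * q ^+ num_components psi omega
    * (\prod_(x : V) (a / (1 - a)) ^+ psi x)
    * (\prod_(e in induced_edges psi) (p / (1 - p)) ^+ omega e)
  else 0.

Definition drc_partition a p q : R :=
  \sum_psi \sum_omega drc_weight a p q psi omega.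

Definition drc_measure a p q psi omega : R :=
  drc_weight a p q psi omega / drc_partition a p q.

Definition edge_marginal a p q omega : R :=
  \sum_psi drc_measure a p q psi omega.

End DilutedRandomCluster.

Arguments edge_marginal {V} E {R} a p q omega.

(* Main.v *)
Require Import Defs.
From mathcomp Require Import all_boot all_order all_algebra.
From mathcomp Require Import reals ring lra.

(* Given the open vertices W, the open edges form a random-cluster measure on
   the edges inside W, which for q >= 1 increases stochastically in W and in p
   by Holley's theorem.  It remains to compare the vertex marginals, whose
   weights are b^|W| Z_p(edges inside W) with b = qa/(1-a) and
   Z_p(A) = sum_(S <= A) r^|A| (p/(1-p))^|S| q^(k S).  Making one more edge
   available multiplies Z_p by the random-cluster mean of a gain taking the
   value 1/r when the ends of the edge are connected, and r(1-1/q) + (1/q)/r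
   otherwise.  For 1 <= q <= 2 this gain is at least 1 and increases with the
   configuration and with p, so Z_p is monotone and log-supermodular, also
   across p1 <= p2, and Holley's theorem applies to the vertex marginals too. *)

Set Implicit Arguments.
Unset Strict Implicit.
Unset Printing Implicit Defensive.

Import Order.TTheory GRing.Theory Num.Theory.
Local Open Scope ring_scope.

(** * The four functions theorem and Holley's inequality *)

Section FourFunctions.
Variables (R : realFieldType) (I : finType).
Implicit Types (S T A B C : {set I}) (f g mu : {set I} -> R).

(** The case of a one-point ground set. The mixed products satisfy [u, v <= P] and [u v <= P Q], so
    [0 <= (P - u)(P - v)] gives [P (u + v) <= P (P + Q)]. *)
Lemma four_functions_two_points (a0 a1 b0 b1 c0 c1 d0 d1 : R) :
  0 <= a0 -> 0 <= a1 -> 0 <= b0 -> 0 <= b1 ->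
  0 <= c0 -> 0 <= c1 -> 0 <= d0 -> 0 <= d1 ->
  a0 * b0 <= c0 * d0 -> a0 * b1 <= c0 * d1 ->
  a1 * b0 <= c0 * d1 -> a1 * b1 <= c1 * d1 ->
  (a0 + a1) * (b0 + b1) <= (c0 + c1) * (d0 + d1).
Proof.
move=> a0P a1P b0P b1P c0P c1P d0P d1P h00 h01 h10 h11.
suff: a0 * b1 + a1 * b0 <= c0 * d1 + c1 * d0 by nra.
have : (a0 * b1) * (a1 * b0) <= (c0 * d1) * (c1 * d0).
  rewrite [leLHS](_ : _ = (a0 * b0) * (a1 * b1)); last by ring.
  rewrite [leRHS](_ : _ = (c0 * d0) * (c1 * d1)); last by ring.
  by apply: ler_pM => //; apply: mulr_ge0.
have := mulr_ge0 c1P d0P; have := mulr_ge0 c0P d1P.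
have := mulr_ge0 a0P b1P; have := mulr_ge0 a1P b0P.
move: h01 h10; set u := a0 * b1; set v := a1 * b0.
set P := c0 * d1; set Q := c1 * d0 => uP vP v0 u0 P0 Q0 uvPQ.
have [P_gt0|] := ltP 0 P; last by lra.
by rewrite -(ler_pM2l P_gt0); nra.
Qed.

Lemma sum_subsetU1 (x : I) A f : x \notin A ->
  \sum_(S : {set I} | S \subset x |: A) f S =
  \sum_(S : {set I} | S \subset A) (f S + f (x |: S)).
Proof.
move=> xA; rewrite (bigID (fun S => x \notin S)) /= big_split /=; congr (_ + _).
  by apply: eq_bigl => S; rewrite -subsetD1 setU1K.
rewrite (reindex_onto (fun S => x |: S) (fun S => S :\ x)) /=; last first.
  by move=> S /andP[_ /negPn xS]; rewrite setD1K.
apply: eq_bigl => S; rewrite setU11 andbT subUset sub1set setU11 /=.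
apply/andP/idP => [[SA /eqP <-]|SA].
  rewrite subDset subUset sub1set setU11 /=.
  by apply: subset_trans SA _.
rewrite setU1K ?eqxx; last by apply: contra xA; apply: (subsetP SA).
by rewrite (subset_trans SA) // subsetUr.
Qed.

(** The Ahlswede-Daykin theorem, by induction on [#|A|]: summing over the presence of one point of
    [A] preserves the hypothesis, by the two-point case. *)
Theorem four_functions (f1 f2 f3 f4 : {set I} -> R) A :
  (forall S, 0 <= f1 S) -> (forall S, 0 <= f2 S) ->
  (forall S, 0 <= f3 S) -> (forall S, 0 <= f4 S) ->
  (forall S T, f1 S * f2 T <= f3 (S :&: T) * f4 (S :|: T)) ->
  (\sum_(S : {set I} | S \subset A) f1 S) * (\sum_(S : {set I} | S \subset A) f2 S) <=
  (\sum_(S : {set I} | S \subset A) f3 S) * (\sum_(S : {set I} | S \subset A) f4 S).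
Proof.
have [n] := ubnP #|A|; elim: n => // n IHn in A f1 f2 f3 f4 *.
move=> cardA f1P f2P f3P f4P f1234.
have [->|[x xA]] := set_0Vmem A.
  have sum0 f : \sum_(S : {set I} | S \subset set0) f S = f set0.
    by rewrite (eq_bigl (pred1 set0)) ?big_pred1_eq // => S; rewrite subset0.
  by rewrite !sum0 (le_trans (f1234 _ _)) // setI0 setU0.
rewrite -(setD1K xA); have xAx : x \notin A :\ x by rewrite setD11.
(* Deleting [x] makes [F f S] depend on [S :\ x] only, so that the hypothesis carries over to all
   [S] and [T], as the induction requires. *)
pose F f S := f (S :\ x) + f (x |: S).
have sumF f : \sum_(S : {set I} | S \subset x |: (A :\ x)) f S =
    \sum_(S : {set I} | S \subset A :\ x) F f S.
  rewrite sum_subsetU1 //; apply: eq_bigr => S /subsetD1P[_ xS]; rewrite /F.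
  by congr (f _ + _); apply/setP => y; rewrite !inE; case: eqP => // ->; apply/negbTE.
rewrite !sumF; apply: IHn; rewrite /F.
- by move: cardA; rewrite (cardsD1 x A) xA.
- by move=> S; apply: addr_ge0.
- by move=> S; apply: addr_ge0.
- by move=> S; apply: addr_ge0.
- by move=> S; apply: addr_ge0.
move=> S T; apply: four_functions_two_points => //.
- by apply: le_trans (f1234 _ _) _; rewrite -setDIl -setDUl.
- apply: le_trans (f1234 _ _) _; rewrite le_eqVlt; apply/orP; left; apply/eqP.
  by congr (f3 _ * f4 _); apply/setP => y; rewrite !inE; case: (y == x).
- apply: le_trans (f1234 _ _) _; rewrite le_eqVlt; apply/orP; left; apply/eqP.
  by congr (f3 _ * f4 _); apply/setP => y; rewrite !inE; case: (y == x).
- by apply: le_trans (f1234 _ _) _; rewrite -setUIr -setUUr.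
Qed.

(** Four functions theorem for [mu1 * g1], [mu2], [mu1], [mu2 * g2], after a shift. Two observables
    are allowed because the gains and conditional means compared later vary with [p] as well. *)
Lemma holley (mu1 mu2 g1 g2 : {set I} -> R) :
  (forall S, 0 <= mu1 S) -> (forall S, 0 <= mu2 S) ->
  (forall S T, mu1 S * mu2 T <= mu1 (S :&: T) * mu2 (S :|: T)) ->
  (forall S T, S \subset T -> g1 S <= g2 T) ->
  (\sum_S mu1 S * g1 S) * (\sum_S mu2 S) <=
  (\sum_S mu1 S) * (\sum_S mu2 S * g2 S).
Proof.
(* Shifting by [m] makes both observables nonnegative and adds the same term to both sides. *)
move=> mu1P mu2P mu12 g12; pose m := \sum_S `|g1 S|.
have g1m S : 0 <= g1 S + m.
  rewrite -lerBlDl sub0r (le_trans (ler_norm _)) // normrN /m (bigD1 S) //=.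
  by rewrite lerDl sumr_ge0.
have g2m S : 0 <= g2 S + m by rewrite (le_trans (g1m S)) // lerD2r g12.
have sumT f : \sum_S f S = \sum_(S : {set I} | S \subset setT) f S.
  by apply: eq_bigl => S; rewrite subsetT.
have sumD mu g : \sum_S mu S * (g S + m) = \sum_S mu S * g S + m * \sum_S mu S.
  by rewrite mulr_sumr -big_split; apply: eq_bigr => S _; rewrite /= mulrDr [m * _]mulrC.
suff : (\sum_S mu1 S * (g1 S + m)) * (\sum_S mu2 S) <=
       (\sum_S mu1 S) * (\sum_S mu2 S * (g2 S + m)).
  by rewrite !sumD mulrDl mulrDr mulrCA -mulrA lerD2r.
rewrite !sumT; apply: four_functions => //; try by move=> S; apply: mulr_ge0.
move=> S T; rewrite mulrAC mulrA ler_pM ?mulr_ge0 //.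
by rewrite lerD2r g12 // subsetUl.
Qed.

(** The points of [S :\: T] move from the factor in [b1] to the factor in [b2]. *)
Lemma expr_card_holley (b1 b2 : R) S T : 0 <= b1 -> b1 <= b2 ->
  b1 ^+ #|S| * b2 ^+ #|T| <= b1 ^+ #|S :&: T| * b2 ^+ #|S :|: T|.
Proof.
move=> b1_ge0 b12; have b2_ge0 := le_trans b1_ge0 b12.
have -> : #|S| = (#|S :&: T| + #|S :\: T|)%N by rewrite cardsID.
have -> : #|S :|: T| = (#|T| + #|S :\: T|)%N.
  by rewrite -(cardsID T (S :|: T)) setIC setKU setDUl setDv setU0.
rewrite !exprD -mulrA; apply: ler_wpM2l; first by rewrite exprn_ge0.
by rewrite mulrC; apply: ler_wpM2l; rewrite ?exprn_ge0 // lerXn2r.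
Qed.

(** A local criterion for Holley's condition. Points of [A :\: B] are removed from [A] one at a
    time, using the step for the nested pair [A :\ x] and [(A :\ x) :|: B]. *)
Lemma mixed_supermodular (F1 F2 : {set I} -> R) :
  (forall S, 0 < F1 S) -> (forall S, 0 < F2 S) ->
  (forall (x : I) C A, C \subset A -> x \notin A ->
     F1 (x |: C) * F2 A <= F1 C * F2 (x |: A)) ->
  forall A B, F1 A * F2 B <= F1 (A :&: B) * F2 (A :|: B).
Proof.
move=> F1P F2P step A B.
have [n] := ubnP #|A :\: B|; elim: n => // n IHn in A *.
have [AB0|[x]] := set_0Vmem (A :\: B).
  have AB : A \subset B by rewrite -setD_eq0 AB0.
  by rewrite (setIidPl AB) (setUidPr AB).
rewrite ltnS => xAB; have /setDP[xA xB] := xAB.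
have -> : A :&: B = (A :\ x) :&: B.
  by apply/setP => y; rewrite !inE; case: eqP => // ->; rewrite (negbTE xB) andbF.
rewrite (cardsD1 x) xAB add1n.
rewrite (_ : (A :\: B) :\ x = (A :\ x) :\: B); last first.
  by rewrite !setDDl setUC.
move=> /IHn IH.
have xA' : x \notin (A :\ x) :|: B by rewrite !inE eqxx.
have := step x (A :\ x) _ (subsetUl _ _) xA'.
rewrite setUA setD1K // => stepx.
(* These two positive factors are common to both sides of the product of [stepx] and the induction
   hypothesis. *)
rewrite -(ler_pM2l (F1P (A :\ x)%SET)) -(ler_pM2r (F2P ((A :\ x) :|: B))).
rewrite [leLHS](_ : _ = (F1 A * F2 ((A :\ x) :|: B)) * (F1 (A :\ x) * F2 B)); last by ring.
rewrite [leRHS](_ : _ = (F1 (A :\ x) * F2 (A :|: B)) *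
  (F1 ((A :\ x) :&: B) * F2 ((A :\ x) :|: B))); last by ring.
by apply: ler_pM => //; apply: mulr_ge0; apply: ltW.
Qed.

End FourFunctions.

(** * Cluster counts and the effect of adding an edge *)

Section Components.
Variables (V : finType) (E : {set {set V}}).
Local Notation edge := {e : {set V} | e \in E}.
Implicit Types (S T : {set edge}) (e : edge).

Definition set_adj S : rel V := fun x y => [exists e in S, val e == [set x; y]].

(** Counted over all of [V], closed vertices being singletons, so that the count depends on the
    edges alone. *)
Definition n_clusters S : nat := n_comp (set_adj S) V.

Lemma set_adj_sym S : connect_sym (set_adj S).
Proof.
by apply: sym_connect_sym => x y; apply: eq_existsb => e; rewrite setUC.
Qed.

Lemma connect_set_adjS S T : S \subset T ->
  subrel (connect (set_adj S)) (connect (set_adj T)).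
Proof.
move=> ST; apply: connect_sub => x y /exists_inP[e eS ve].
by apply/connect1/exists_inP; exists e => //; apply: (subsetP ST).
Qed.

Lemma set_adjU1 S e x y u v : val e = [set x; y] ->
  set_adj (e |: S) u v -> set_adj S u v \/ u \in pred2 x y /\ v \in pred2 x y.
Proof.
move=> exy /exists_inP[e']; rewrite !inE => /orP[/eqP->|e'S] /eqP euv; last first.
  by left; apply/exists_inP; exists e' => //; apply/eqP.
have uv w : (w \in [set u; v]) = (w \in [set x; y]) by rewrite -euv exy.
by right; have := uv u; have := uv v; rewrite !inE !eqxx ?orbT => <- <-.
Qed.

(** The new edge can only merge the clusters of [x] and [y]. *)
Lemma n_clustersU1 S e x y : val e = [set x; y] ->
  (n_clusters S = n_clusters (e |: S) + ~~ connect (set_adj S) x y)%N.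
Proof.
move=> exy; set T := e |: S; have symS := set_adj_sym S; have symT := set_adj_sym T.
have ST : S \subset T by apply: subsetUr.
(* The union of the clusters of [x] and [y] in [S]. It is closed for both adjacencies, so each count
   splits into a part inside [a] and a common part outside. *)
pose a := [in closure (set_adj S) (pred2 x y)].
have aP u : reflect (exists2 w, w \in pred2 x y & connect (set_adj S) u w) (u \in a).
  by apply: (iffP pred0Pn) => -[w]; [case/andP|]; exists w => //; apply/andP.
have xyT : connect (set_adj T) x y.
  by apply/connect1/exists_inP; exists e; rewrite ?setU11 // exy.
have closedS : closed (set_adj S) a by apply: closure_closed.
have a_xy u : u \in pred2 x y -> u \in a by move=> uxy; apply/aP; exists u.
have closedT : closed (set_adj T) a.
  move=> u v /(set_adjU1 exy)[/closedS //|[uxy vxy]].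
  by rewrite -!topredE /= -![_ u]/(u \in a) -![_ v]/(v \in a) !a_xy.
have connE u : u \notin a -> connect (set_adj T) u =1 connect (set_adj S) u.
  move=> ua v; apply/idP/idP; last exact: connect_set_adjS.
  move=> /connectP[p + ->]; elim: p u ua => //= w p IHp u ua /andP[uw pw].
  have wa : w \notin a by rewrite -(closedT _ _ uw).
  apply: connect_trans (IHp _ wa pw); apply: connect1.
  by case/(set_adjU1 exy): uw => // -[/a_xy]; rewrite (negbTE ua).
rewrite /n_clusters !(n_compC a) addnAC; congr (_ + _)%N; last first.
  apply: eq_card => u; rewrite !inE /= -[X in ~~ X]/(u \in a).
  case: (boolP (u \in a)) => ua /=; first by rewrite !andbF.
  rewrite !andbT; apply: (congr1 (fun r => odflt u r == u)).
  by apply/esym/eq_pick/connE.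
rewrite n_comp_closure2 //.
(* Inside [a], [T] has the single cluster containing [x] and [y], while [S] has one or two. *)
have -> : n_comp (set_adj T) a = n_comp (set_adj T) (closure (set_adj T) (pred2 x y)).
  apply: eq_n_comp_r => u; apply/idP/idP.
    move=> /aP[w wxy uw]; apply/pred0Pn; exists w; apply/andP; split => //.
    exact: connect_set_adjS uw.
  move=> /pred0Pn[w /andP[/= uw wxy]].
  by rewrite (closed_connect closedT uw); apply: a_xy.
by rewrite n_comp_closure2 // xyT add1n.
Qed.

(** No open edge meets a closed vertex, so each closed vertex is its own cluster. *)
Lemma n_clusters_num_components (psi : {ffun V -> bool}) (omega : {ffun edge -> bool}) :
  compatible psi omega ->
  n_clusters (open_edges omega) =
    (num_components psi omega + #|~: open_vertices psi|)%N.
Proof.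
move=> /subsetP compat; rewrite /n_clusters (n_compC (open_vertices psi)).
congr (_ + _)%N; apply: eq_card => u; rewrite !inE /=.
case: (boolP (psi u)) => psiu /=; first by rewrite andbF.
rewrite andbT; have /connectP[[|w p] /= pu lu] := connect_root (set_adj (open_edges omega)) u.
  by rewrite /roots lu eqxx.
move: pu => /andP[/exists_inP[e /compat + /eqP euw] _].
rewrite inE euw => /subsetP/(_ u); rewrite !inE eqxx (negbTE psiu).
by move=> /(_ isT).
Qed.

End Components.

(* Random-cluster weights for an abstract cluster count [k], of which only two
   facts matter: adding an edge decreases [k] by 0 or 1, and by 1 less often
   in larger configurations. *)
Section RandomCluster.
Variables (R : realType) (I : finType) (k : {set I} -> nat).
Variable bridge : I -> {set I} -> bool.
Hypothesis kU1 : forall e (S : {set I}), k S = (k (e |: S) + bridge e S)%N.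
Hypothesis bridge_anti : forall e (S T : {set I}), S \subset T -> bridge e T -> bridge e S.
Implicit Types (S T A B C : {set I}) (e : I) (p q : R).

(* The factor [r ^ |A|] is irrelevant for means but not for [rc_partition],
   which enters the vertex marginal. *)
Definition rc_weight p q A S : R :=
  if S \subset A then
    Num.sqrt (1 - p) ^+ #|A| * (p / (1 - p)) ^+ #|S| * q ^+ k S
  else 0.

Definition rc_partition p q A : R := \sum_S rc_weight p q A S.

(* The factor by which the total weight of [S] and [e |: S] with [e] available
   exceeds the weight of [S] without it. *)
Definition edge_gain p q e S : R :=
  Num.sqrt (1 - p) *
  (1 + p / (1 - p) * (q ^+ k (e |: S) / q ^+ k S)).

Lemma rc_weight_ge0 p q A S : 0 < p < 1 -> 0 < q -> 0 <= rc_weight p q A S.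
Proof.
move=> /andP[p0 p1] q0; rewrite /rc_weight; case: ifP => // _.
by rewrite !mulr_ge0 ?exprn_ge0 ?sqrtr_ge0 ?divr_ge0 ?subr_ge0 // ltW.
Qed.

Lemma rc_partition_gt0 p q A : 0 < p < 1 -> 0 < q -> 0 < rc_partition p q A.
Proof.
move=> p01 q0; rewrite /rc_partition (bigD1 set0) //= ltr_pwDl //; last first.
  by apply: sumr_ge0 => S _; apply: rc_weight_ge0.
rewrite /rc_weight sub0set cards0 expr0 mulr1 mulr_gt0 ?exprn_gt0 //.
by rewrite sqrtr_gt0 subr_gt0; case/andP: p01.
Qed.

(** If [e] merges clusters of [A], it does so in any smaller [C]; for [q >= 1] this is the one-point
    criterion. *)
Lemma expr_k_mixed q : 1 <= q -> forall A B,
  q ^+ k A * q ^+ k B <=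
  q ^+ k (A :&: B) * q ^+ k (A :|: B).
Proof.
move=> q1; have q0 : 0 < q by apply: lt_le_trans q1.
apply: mixed_supermodular => [S|S|e C A CA eA]; rewrite ?exprn_gt0 //.
rewrite (kU1 e C) (kU1 e A) -!exprD ler_weXn2l //.
rewrite -addnA leq_add2l addnC leq_add2r.
by case: (boolP (bridge e A)) => // /(bridge_anti CA)->.
Qed.

Lemma odds_le p1 p2 : p1 <= p2 -> p2 < 1 -> p1 / (1 - p1) <= p2 / (1 - p2).
Proof.
move=> p12 p2_1; rewrite ler_pdivrMr ?subr_gt0 ?(le_lt_trans p12) //.
rewrite mulrAC ler_pdivlMr ?subr_gt0 //; nra.
Qed.

(** The condition factors into powers of the odds and of [q]. The inclusion of [A] in [B] keeps
    [S :|: T] in the support. *)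
Lemma rc_weight_holley p1 p2 q A B : 0 < p1 -> p1 <= p2 -> p2 < 1 -> 1 <= q ->
  A \subset B -> forall S T,
  rc_weight p1 q A S * rc_weight p2 q B T <=
  rc_weight p1 q A (S :&: T) * rc_weight p2 q B (S :|: T).
Proof.
move=> p1_0 p12 p2_1 q1 AB S T.
have q0 : 0 < q by apply: lt_le_trans q1.
have p1_01 : 0 < p1 < 1 by rewrite p1_0 (le_lt_trans p12).
have p2_01 : 0 < p2 < 1 by rewrite (lt_le_trans p1_0).
case: (boolP (S \subset A)) => SA; last first.
  by rewrite {1}/rc_weight (negbTE SA) mul0r mulr_ge0 ?rc_weight_ge0.
case: (boolP (T \subset B)) => TB; last first.
  by rewrite {2}/rc_weight (negbTE TB) mulr0 mulr_ge0 ?rc_weight_ge0.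
rewrite /rc_weight SA TB (subset_trans (subsetIl _ _) SA) subUset TB.
rewrite (subset_trans SA AB) /=.
set r1 := _ ^+ #|A|; set r2 := _ ^+ #|B|.
set b1 := p1 / _; set b2 := p2 / _.
rewrite mulrACA [leRHS]mulrACA [X in X * _ <= _]mulrACA [X in _ <= X * _]mulrACA.
have b1_ge0 : 0 <= b1 by case/andP: p1_01 => *; rewrite divr_ge0 ?subr_ge0 ?ltW.
have b2_ge0 : 0 <= b2 by rewrite (le_trans b1_ge0) // odds_le.
have q_ge0 := ltW q0.
have [r1_ge0 r2_ge0] : 0 <= r1 /\ 0 <= r2 by split; rewrite exprn_ge0 // sqrtr_ge0.
apply: ler_pM; rewrite ?mulr_ge0 ?exprn_ge0 ?sqrtr_ge0 //; last exact: expr_k_mixed.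
apply: ler_wpM2l; first exact: mulr_ge0.
by apply: expr_card_holley => //; apply: odds_le.
Qed.

(** The mixture increases with [c] as [r <= 1/r], and decreases in [r] as its derivative
    [1 - c - c/r^2] is at most [1 - 2c <= 0]. *)
Lemma mixture_inv_le (c1 c2 r1 r2 : R) :
  2^-1 <= c1 -> c1 <= c2 -> c2 <= 1 -> 0 < r2 -> r2 <= r1 -> r1 <= 1 ->
  r1 * (1 - c1) + c1 / r1 <= r2 * (1 - c2) + c2 / r2.
Proof.
move=> c1h c12 c2_1 r2_0 r21 r1_1; have r1_0 := lt_le_trans r2_0 r21.
have r1i : 1 <= r1^-1 by rewrite invf_ge1.
have r12i : r1^-1 <= r2^-1 by rewrite lef_pV2.
have : r1 - r2 <= r2^-1 - r1^-1.
  have -> : r2^-1 - r1^-1 = (r1 - r2) * (r2^-1 * r1^-1) by field; lra.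
  by rewrite ler_peMr ?subr_ge0 // mulr_ege1 // (le_trans r1i).
move: r1i r12i; set s1 := r1^-1; set s2 := r2^-1 => s1_1 s12 gap.
(* The difference of the two sides is exactly the sum of the next three products. *)
have : 0 <= c1 * (s2 - s1 - (r1 - r2)) by apply: mulr_ge0; lra.
have : 0 <= (2 * c1 - 1) * (r1 - r2) by apply: mulr_ge0; lra.
have : 0 <= (c2 - c1) * (s2 - r2) by apply: mulr_ge0; lra.
lra.
Qed.

(** Substitute [p = 1 - r^2]; the ratio of powers of [q] is [c], namely [1/q] for a bridge and 1
    otherwise. *)
Lemma edge_gain_bridge p q e S : 0 < p < 1 -> 0 < q ->
  let c := (q ^+ bridge e S)^-1 in
  let r := Num.sqrt (1 - p) in
  edge_gain p q e S = r * (1 - c) + c / r.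
Proof.
move=> /andP[p0 p1] q0 c r; have r0 : 0 < r by rewrite sqrtr_gt0 subr_gt0.
have r2 : r ^+ 2 = 1 - p by rewrite sqr_sqrtr // subr_ge0 ltW.
rewrite /edge_gain -/r (kU1 e S) exprD invfM mulVKf ?gt_eqF ?exprn_gt0 // -/c.
have -> : p = 1 - r ^+ 2 by rewrite r2; ring.
by rewrite opprB addrCA subrr addr0; field; rewrite gt_eqF.
Qed.

(** Enlarging [S] raises [c] and enlarging [p] lowers [r]. The bound [q <= 2] gives [c >= 1/2]. *)
Lemma edge_gain_le p1 p2 q e S T : 0 < p1 -> p1 <= p2 -> p2 < 1 -> 1 <= q -> q <= 2 ->
  S \subset T -> edge_gain p1 q e S <= edge_gain p2 q e T.
Proof.
move=> p1_0 p12 p2_1 q1 q2 ST.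
have q0 : 0 < q by apply: lt_le_trans q1.
have p1_01 : 0 < p1 < 1 by rewrite p1_0 (le_lt_trans p12).
have p2_01 : 0 < p2 < 1 by rewrite (lt_le_trans p1_0).
rewrite (edge_gain_bridge _ _ p1_01 q0) (edge_gain_bridge _ _ p2_01 q0).
have qi : q^-1 <= 1 by rewrite invf_le1.
apply: mixture_inv_le.
- case: bridge => /=; rewrite ?expr0 ?expr1 ?invr1; last by lra.
  by rewrite lef_pV2 ?posrE.
- case: (boolP (bridge e T)) => [/(bridge_anti ST)-> //|_].
  by case: bridge; rewrite /= ?expr0 ?expr1 ?invr1.
- by case: bridge; rewrite /= ?expr0 ?expr1 ?invr1.
- by rewrite sqrtr_gt0 subr_gt0.
- by rewrite ler_wsqrtr // lerD2l lerN2.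
- by rewrite -[leRHS]sqrtr1 ler_wsqrtr // gerBl ltW.
Qed.

Lemma edge_gain_ge1 p q e S : 0 < p < 1 -> 1 <= q -> q <= 2 -> 1 <= edge_gain p q e S.
Proof.
move=> p01 q1 q2.
have q0 : 0 < q by apply: lt_le_trans q1.
have [p0 p1] := andP p01.
have qi : q^-1 <= 1 by rewrite invf_le1.
rewrite (edge_gain_bridge _ _ p01 q0).
set c := (_ ^+ _)^-1.
(* The value 1 is the mixture with the same [c] at [r = 1]. *)
rewrite [leLHS](_ : _ = 1 * (1 - c) + c / 1); last by rewrite invr1; ring.
apply: mixture_inv_le => //; rewrite /c.
- case: bridge => /=; rewrite ?expr0 ?expr1 ?invr1; last by lra.
  by rewrite lef_pV2 ?posrE.
- by case: bridge; rewrite /= ?expr0 ?expr1 ?invr1.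
- by rewrite sqrtr_gt0 subr_gt0.
- by rewrite -[leRHS]sqrtr1 ler_wsqrtr // gerBl ltW.
Qed.

(** Pairing [S] with [e |: S] turns a ratio of partition functions into a mean gain, to which
    Holley's inequality applies. *)
Lemma rc_partitionU1 p q e A : 0 < q -> e \notin A ->
  rc_partition p q (e |: A) = \sum_S rc_weight p q A S * edge_gain p q e S.
Proof.
move=> q0 eA; rewrite /rc_partition /rc_weight -big_mkcond /= sum_subsetU1 //.
rewrite big_mkcond /=; apply: eq_bigr => S _; case: ifP => SA; rewrite ?mul0r //.
have eS : e \notin S by apply: contra eA; apply: (subsetP SA).
rewrite !cardsU1 eA eS /edge_gain !exprS; set b := p / _.
by field; rewrite gt_eqF ?exprn_gt0.
Qed.

(** The one-point criterion says that the mean gain under [p1] on [C] is at most that under [p2] on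
    [A]. *)
Lemma rc_partition_mixed p1 p2 q : 0 < p1 -> p1 <= p2 -> p2 < 1 -> 1 <= q -> q <= 2 ->
  forall A B, rc_partition p1 q A * rc_partition p2 q B <=
    rc_partition p1 q (A :&: B) * rc_partition p2 q (A :|: B).
Proof.
move=> p1_0 p12 p2_1 q1 q2.
have q0 : 0 < q by apply: lt_le_trans q1.
have p1_01 : 0 < p1 < 1 by rewrite p1_0 (le_lt_trans p12).
have p2_01 : 0 < p2 < 1 by rewrite (lt_le_trans p1_0).
apply: mixed_supermodular => [S|S|e C A CA eA]; try exact: rc_partition_gt0.
have eC : e \notin C by apply: contra eA; apply: (subsetP CA).
rewrite !rc_partitionU1 //; apply: holley => [S|S|S T|S T ST].
- exact: rc_weight_ge0.
- exact: rc_weight_ge0.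
- exact: rc_weight_holley.
- exact: edge_gain_le.
Qed.

(** Edges are added one at a time, each with gain at least 1. *)
Lemma rc_partition_le p q A B : 0 < p < 1 -> 1 <= q -> q <= 2 ->
  A \subset B -> rc_partition p q A <= rc_partition p q B.
Proof.
move=> p01 q1 q2; have q0 : 0 < q by apply: lt_le_trans q1.
have [n] := ubnP #|B|; elim: n => // n IHn in B *.
have [/eqP|[e eBA]] := set_0Vmem (B :\: A).
  by rewrite setD_eq0 => BA _ AB; rewrite (_ : A = B) //; apply/eqP; rewrite eqEsubset AB.
have [eB eA] := setDP eBA; rewrite (cardsD1 e) eB => cardB AB.
have /IHn IH : A \subset B :\ e by rewrite subsetD1 AB.
apply: le_trans (IH _) _ => //; rewrite -[in leRHS](setD1K eB).
rewrite rc_partitionU1 ?setD11 //; apply: ler_sum => S _.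
by apply: ler_peMr; [exact: rc_weight_ge0 | exact: edge_gain_ge1].
Qed.

Definition rc_mean p q A (F : {set I} -> R) : R :=
  (\sum_S rc_weight p q A S * F S) / rc_partition p q A.

Lemma rc_mean_le p1 p2 q A B (F : {set I} -> R) :
  0 < p1 -> p1 <= p2 -> p2 < 1 -> 1 <= q ->
  A \subset B -> (forall S T : {set I}, S \subset T -> F S <= F T) ->
  rc_mean p1 q A F <= rc_mean p2 q B F.
Proof.
move=> p1_0 p12 p2_1 q1 AB monoF.
have q0 : 0 < q by apply: lt_le_trans q1.
have p1_01 : 0 < p1 < 1 by rewrite p1_0 (le_lt_trans p12).
have p2_01 : 0 < p2 < 1 by rewrite (lt_le_trans p1_0).
rewrite /rc_mean ler_pdivrMr ?rc_partition_gt0 // mulrAC.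
rewrite ler_pdivlMr ?rc_partition_gt0 // [leRHS]mulrC.
apply: holley => // [S|S|S T]; try exact: rc_weight_ge0.
exact: rc_weight_holley.
Qed.

(** * Stochastic comparison of the open vertex sets *)

Section Dilution.
Variables (V : finType) (D : {set V} -> {set I}).
Hypothesis DI : forall W W' : {set V}, D (W :&: W') = D W :&: D W'.
Implicit Types (W : {set V}) (b : R).

(** The unnormalised law of the open vertex set, edges summed out; [D W] stands for the edges made
    available by [W]. *)
Definition vertex_weight b p q W : R := b ^+ #|W| * rc_partition p q (D W).

Lemma vertex_weight_gt0 b p q W : 0 < b -> 0 < p < 1 -> 0 < q ->
  0 < vertex_weight b p q W.
Proof. by move=> *; rewrite mulr_gt0 ?exprn_gt0 ?rc_partition_gt0. Qed.

(** Holley's inequality on vertex sets, with the conditional means given [W] as observables. *)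
Lemma diluted_mean_le b1 b2 p1 p2 q (F : {set I} -> R) :
  0 < b1 -> b1 <= b2 -> 0 < p1 -> p1 <= p2 -> p2 < 1 -> 1 <= q -> q <= 2 ->
  (forall S T : {set I}, S \subset T -> F S <= F T) ->
  (\sum_W vertex_weight b1 p1 q W * rc_mean p1 q (D W) F) /
    (\sum_W vertex_weight b1 p1 q W) <=
  (\sum_W vertex_weight b2 p2 q W * rc_mean p2 q (D W) F) /
    (\sum_W vertex_weight b2 p2 q W).
Proof.
move=> b1_0 b12 p1_0 p12 p2_1 q1 q2 monoF.
have q0 : 0 < q by apply: lt_le_trans q1.
have b2_0 : 0 < b2 by apply: lt_le_trans b12.
have p1_01 : 0 < p1 < 1 by rewrite p1_0 (le_lt_trans p12).
have p2_01 : 0 < p2 < 1 by rewrite (lt_le_trans p1_0).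
have sum_gt0 b p : 0 < b -> 0 < p < 1 -> 0 < \sum_W vertex_weight b p q W.
  move=> b0 p01; rewrite (bigD1 set0) //= ltr_pwDl ?vertex_weight_gt0 //.
  by apply: sumr_ge0 => W _; apply/ltW/vertex_weight_gt0.
have monoD W W' : W \subset W' -> D W \subset D W'.
  by move=> /setIidPl WW'; rewrite -WW' DI subsetIr.
rewrite ler_pdivrMr ?sum_gt0 // mulrAC ler_pdivlMr ?sum_gt0 // [leRHS]mulrC.
apply: holley => [W|W|W W'|W W' WW']; try exact/ltW/vertex_weight_gt0.
  rewrite /vertex_weight mulrACA [leRHS]mulrACA.
  have Z_ge0 p A : 0 < p < 1 -> 0 <= rc_partition p q A.
    by move=> p01; apply/ltW/rc_partition_gt0.
  apply: ler_pM; rewrite ?mulr_ge0 ?exprn_ge0 ?Z_ge0 //; try exact: ltW.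
    by apply: expr_card_holley => //; apply: ltW.
  (* This yields [D W :|: D W'], which may be smaller than [D (W :|: W')]; monotonicity of the
     partition function closes the gap. *)
  apply: le_trans (rc_partition_mixed _ _ _ _ _ _ _) _ => //.
  rewrite -DI; apply: ler_wpM2l; first exact: Z_ge0.
  by apply: rc_partition_le => //; rewrite subUset !monoD ?subsetUl ?subsetUr.
by apply: rc_mean_le => //; apply: monoD.
Qed.

End Dilution.

End RandomCluster.

Lemma sum_ffun_set (R : nmodType) (T : finType) (G : {set T} -> R) :
  \sum_(w : {ffun T -> bool}) G [set i | w i] = \sum_S G S.
Proof.
rewrite [RHS](reindex (fun w : {ffun T -> bool} => [set i | w i])) //=.
exists (fun S : {set T} => [ffun i => i \in S]) => [w|S] _.
  by apply/ffunP => i; rewrite ffunE inE.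
by apply/setP => i; rewrite inE ffunE.
Qed.

(** * The diluted measure as a choice of vertices, then of edges *)

Section EdgeMarginal.
Variables (R : realType) (V : finType) (E : {set {set V}}).
Local Notation edge := {e : {set V} | e \in E}.
Implicit Types (a p q : R).

Definition edges_inside (W : {set V}) : {set edge} := [set e : edge | val e \subset W].

(** Counting closed vertices as clusters costs [q ^ (|V| - |W|)]: [q ^ |W|] joins the vertex odds,
    and the constant [q ^ |V|] cancels on normalisation. *)
Lemma drc_weightE a p q (psi : {ffun V -> bool}) (omega : {ffun edge -> bool}) :
  0 < q ->
  drc_weight a p q psi omega =
  (q * (a / (1 - a))) ^+ #|open_vertices psi| / q ^+ #|V| *
  rc_weight (@n_clusters V E) p q (edges_inside (open_vertices psi)) (open_edges omega).
Proof.
move=> q0; rewrite /drc_weight /rc_weight -[_ \subset _]/(compatible psi omega).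
case: ifP => compat; last by rewrite mulr0.
rewrite -[edges_inside _]/(induced_edges E psi) (n_clusters_num_components compat).
have -> : \prod_x (a / (1 - a)) ^+ psi x = (a / (1 - a)) ^+ #|open_vertices psi|.
  rewrite -prodr_const big_mkcond [RHS]big_mkcond /=.
  by apply: eq_bigr => x _; rewrite !inE; case: (psi x).
have -> : \prod_(e in induced_edges E psi) (p / (1 - p)) ^+ omega e =
    (p / (1 - p)) ^+ #|open_edges omega|.
  rewrite -prodr_const big_mkcond [RHS]big_mkcond /=; apply: eq_bigr => e _.
  have := subsetP compat e; rewrite !inE; case: (omega e) => [->|_] //.
  by rewrite expr0 if_same.
move: (a / (1 - a)) (p / (1 - p)) => b c; rewrite -(cardsC (open_vertices psi)) exprMn !exprD.
have x0 : q ^+ #|open_vertices psi| != 0 by rewrite gt_eqF ?exprn_gt0.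
have y0 : q ^+ #|~: open_vertices psi| != 0 by rewrite gt_eqF ?exprn_gt0.
move: (q ^+ #|open_vertices psi|) (q ^+ #|~: _|) x0 y0 => x y x0 y0.
move: (Num.sqrt _ ^+ _) (q ^+ _) (b ^+ _) (c ^+ _).
by move=> r z t u; field; rewrite x0 y0.
Qed.

Lemma expectation_edge_marginal a p q (f : {ffun edge -> bool} -> R) :
  0 < p < 1 -> 0 < q ->
  let k := @n_clusters V E in
  let N := vertex_weight k edges_inside (q * (a / (1 - a))) p q in
  expectation (edge_marginal E a p q) f =
  (\sum_W N W * rc_mean k p q (edges_inside W) (fun S => f [ffun e => e \in S])) /
    (\sum_W N W).
Proof.
move=> p01 q0 k N; pose F (S : {set edge}) := f [ffun e => e \in S].
(* Stated for any [G], since [G = 1] gives the partition function and [G = F] the numerator. *)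
have sumE G : \sum_psi \sum_omega drc_weight a p q psi omega * G (open_edges omega) =
    (q ^+ #|V|)^-1 * \sum_W N W * rc_mean k p q (edges_inside W) G.
  rewrite mulr_sumr -[RHS]sum_ffun_set; apply: eq_bigr => psi _.
  rewrite -[[set i | psi i]]/(open_vertices psi) /N /vertex_weight /rc_mean.
  rewrite -mulrA [rc_partition _ _ _ _ * _]mulrC divfK; last first.
    by rewrite gt_eqF ?rc_partition_gt0.
  rewrite [RHS]mulrA mulr_sumr -[RHS]sum_ffun_set; apply: eq_bigr => omega _.
  by rewrite drc_weightE // [_ / q ^+ _]mulrC !mulrA.
have Z0 : (q ^+ #|V|)^-1 != 0 by rewrite invr_eq0 gt_eqF ?exprn_gt0.
have sumZ : drc_partition E a p q = (q ^+ #|V|)^-1 * \sum_W N W.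
  rewrite /drc_partition.
  transitivity (\sum_psi \sum_omega @drc_weight V E R a p q psi omega * 1).
    by apply: eq_bigr => psi _; apply: eq_bigr => omega _; rewrite mulr1.
  rewrite (sumE (fun=> 1)); congr (_ * _); apply: eq_bigr => W _.
  rewrite /rc_mean (eq_bigr _ (fun S _ => mulr1 _)) divff ?mulr1 //.
  by rewrite gt_eqF ?rc_partition_gt0.
transitivity ((\sum_psi \sum_omega @drc_weight V E R a p q psi omega * F (open_edges omega))
  / drc_partition E a p q); last first.
  by rewrite sumE sumZ -mulf_div divff // mul1r.
rewrite /expectation /edge_marginal exchange_big mulr_suml; apply: eq_bigr => omega _.
have -> : F (open_edges omega) = f omega.
  by rewrite /F; congr f; apply/ffunP => e; rewrite ffunE inE.
rewrite !mulr_suml; apply: eq_bigr => psi _.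
by rewrite /drc_measure mulrAC.
Qed.

End EdgeMarginal.

Theorem theorem6p3 (R : realType) (V : finType) (E : {set {set V}})
    (hE : simple_graph E) (a1 a2 p1 p2 q : R)
    (ha1 : 0 < a1) (ha12 : a1 <= a2) (ha2 : a2 < 1)
    (hp1 : 0 < p1) (hp12 : p1 <= p2) (hp2 : p2 < 1)
    (hq1 : 1 <= q) (hq2 : q <= 2) :
  st_le (edge_marginal E a1 p1 q) (edge_marginal E a2 p2 q).
Proof.
move=> f incf; have q0 : 0 < q by apply: lt_le_trans hq1.
pose k := @n_clusters V E.
have ends (e : {e : {set V} | e \in E}) : exists x y, val e = [set x; y].
  by have /eqP/cards2P[x [y [_ ->]]] := hE _ (valP e); exists x, y.
(* Defined by the drop in [k], which avoids choosing ends; by [bridgeE] it means that the ends are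
   not connected, a property inherited by subsets. *)
pose bridge (e : {e : {set V} | e \in E}) S := (k (e |: S) < k S)%N.
have bridgeE e S x y : val e = [set x; y] -> bridge e S = ~~ connect (set_adj S) x y.
  move=> exy; rewrite /bridge /k (n_clustersU1 S exy) -[X in (X < _)%N]addn0 ltn_add2l.
  by case: connect.
have kU1 e S : k S = (k (e |: S) + bridge e S)%N.
  by have [x [y exy]] := ends e; rewrite (bridgeE _ _ _ _ exy); apply: n_clustersU1.
have bridge_anti e (S T : {set {e : {set V} | e \in E}}) :
    S \subset T -> bridge e T -> bridge e S.
  have [x [y exy]] := ends e; rewrite !(bridgeE _ _ _ _ exy) => ST.
  by apply/contra/connect_set_adjS.
have p1_01 : 0 < p1 < 1 by rewrite hp1 (le_lt_trans hp12).
have p2_01 : 0 < p2 < 1 by rewrite hp2 (lt_le_trans hp1).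
rewrite !expectation_edge_marginal //.
apply: (diluted_mean_le kU1 bridge_anti) => //.
- by move=> W W'; apply/setP => e; rewrite !inE subsetI.
- by rewrite mulr_gt0 ?divr_gt0 ?subr_gt0 ?(le_lt_trans ha12).
- by rewrite ler_wpM2l ?odds_le // ltW.
move=> S T /subsetP ST; apply: incf => e; rewrite !ffunE.
by case: (boolP (e \in S)) => // /ST ->.
Qed.
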